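(* For every two integers $n\ge 1$ and $k\ge 1$ and every $n$-vertex tree $T$, there is a shortcutting of $T$ with hop-diameter $k$ and arboricity $O(\log^{12/(k+4)} n)$. Moreover, when the height of the tree is $h$, the arboricity is $O(h^{6/(k+4)})$.
   Context: Let $T=(V,E)$ be a tree with shortest-path metric $d_T$. A shortcutting of $T$ with hop-diameter $k$ is a graph $G=(V,E')$, each edge $(x,y)$ having length $d_T(x,y)$, such that for all $u,v\in V$ there is a $u$–$v$ path in $G$ with at most $k$ edges and length exactly $d_T(u,v)$. The arboricity of a graph $G$ is $\max_{H\subseteq G, |V(H)|\ge 2}\lceil |E(H)|/(|V(H)|-1)\rceil$ (equivalently, the minimum number of forests into which its edges can be partitioned).
   Formalization: The log bound is claimed only for k≠1 and the height bound only for k≠1,3, as they fail there: for k=1 the shortcutting is the complete graph, of arboricity ⌈n/2⌉; for k=3 height-h trees of very large branching force arboricity of order h, above h^{6/7}. *)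

(* Defs.v *)
From mathcomp Require Import all_boot.

Set Implicit Arguments.
Unset Strict Implicit.
Unset Printing Implicit Defensive.

(* A finite simple graph on V is a symmetric irreflexive relation. *)
Definition is_graph (V : finType) (e : rel V) : Prop :=
  symmetric e /\ irreflexive e.

(* The size condition excludes the closed walks [:: x; y] along an edge. *)
Definition acyclic (V : finType) (e : rel V) : Prop :=
  forall c : seq V, 2 < size c -> ~ ucycle e c.

Definition is_tree (V : finType) (e : rel V) : Prop :=
  [/\ is_graph e, 0 < #|V|, (forall x y : V, connect e x y) & acyclic e].

Definition has_walk (V : finType) (e : rel V) (x y : V) (l : nat) : bool :=
  [exists p : l.-tuple V, path e x p && (last x p == y)].

(* The least number of edges of a walk from x to y; shortest walks have fewer
   than #|V| edges.  The junk value #|V| is taken only when y cannot be reached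
   from x, which never happens in a tree. *)
Definition gdist (V : finType) (e : rel V) (x y : V) : nat :=
  find (has_walk e x y) (iota 0 #|V|).

Definition height (V : finType) (e : rel V) (r : V) : nat :=
  \max_(v : V) gdist e r v.

(* The length of the path u :: p when each step (x, y) has length d x y. *)
Definition plength (V : Type) (d : V -> V -> nat) (u : V) (p : seq V) : nat :=
  sumn (pairmap d u p).

(* The number of edges of the path u :: p is size p. *)
Definition is_shortcutting (V : finType) (e : rel V) (k : nat) (g : rel V) :
    Prop :=
  is_graph g /\
  forall u v : V, exists p : seq V,
    [/\ path g u p /\ last u p = v, uniq (u :: p), size p <= k
      & plength (gdist e) u p = gdist e u v].

Definition edge_set (V : finType) (g : rel V) : {set {set V}} :=
  [set [set p.1; p.2] | p : V * V & g p.1 p.2].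

(* H is a pair (vertex set, edge set). *)
Definition subgraph (V : finType) (g : rel V) (H : {set V} * {set {set V}}) :
    bool :=
  (H.2 \subset edge_set g) && [forall f in H.2, f \subset H.1].

Definition ceil_div (m d : nat) : nat := (m + d.-1) %/ d.

Definition arboricity (V : finType) (g : rel V) : nat :=
  \max_(H : {set V} * {set {set V}} | subgraph g H && (2 <= #|H.1|))
     ceil_div #|H.2| (#|H.1| - 1).

(* Main.v *)
Require Import Defs.
From mathcomp Require Import all_boot all_order all_algebra zify lra.
From mathcomp Require Import reals exp.

(* Orienting the edges of a graph with out-degree at most D bounds its
   arboricity by 2D, so it suffices to give every vertex few out-edges.

   On the integers below h one can descend between any two numbers in t steps
   with out-degree t B if B^t >= h (base-B digits), and in 2t steps with
   out-degree 2B + 1 if B^t >= h (a preorder of the complete B-ary tree).  The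
   first is used for small t and the second for large t, where a factor t would
   not be a constant.  Either scheme lifts to the iterates of any map.

   Height: lift along the parent map, and go from u up to the lowest common
   ancestor and down to v, with k/2 hops on each side.

   Number of vertices: let the rank of v be the integer part of log_2 of the
   size of its subtree.  Vertices of equal rank form descending paths, and only
   O(log n) ranks are met on the way to the root.  Let w be the lowest common
   ancestor of u and v.  From u climb to the path of w along the map
   "nearest ancestor of larger rank", likewise from v; one of the two climbs
   ends in w.  Two points of one path meet at the vertex between them whose
   depth is divisible by the largest power of 2, each following the map "next
   vertex of larger 2-adic valuation".  These are four climbs of O(log n)
   records each, with k/4 hops per climb.  For k < 4 use the centroid
   decomposition with two hops.

   A tree carries one graph for each bound; the one of smaller arboricity
   satisfies both. *)

Set Implicit Arguments.
Unset Strict Implicit.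
Unset Printing Implicit Defensive.

(** * Hop schemes on the integers *)

(** A hop may stand still, so [t] only bounds the real moves. No hop passes below [j], which makes
    the lifted walks geodesic. *)
Fixpoint nhop (O : nat -> seq nat) (t i j : nat) : Prop :=
  if t is t'.+1 then
    exists m, [/\ j <= m <= i, (m == i) || (m \in O i) & nhop O t' m j]
  else i = j.

Definition scheme (h t D : nat) (O : nat -> seq nat) : Prop :=
  (forall i, i < h -> size (O i) <= D) /\
  (forall i j, j <= i < h -> nhop O t i j).

Lemma nhop_le O t i j : nhop O t i j -> j <= i.
Proof. by elim: t i => [|t _] i /= => [->//|[m [/andP[jm mi] _ _]]]; lia. Qed.

Lemma nhop_trans O s t i j l :
  nhop O s i j -> nhop O t j l -> nhop O (s + t) i l.
Proof.
elim: s i => [|s IHs] i /= => [->//|[m [jmi hm Hm]] Hj].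
by exists m; split=> //; [have := nhop_le Hj; lia | apply: IHs].
Qed.

Lemma nhop_widen O s t i j : s <= t -> nhop O s i j -> nhop O t i j.
Proof.
elim: t s i => [|t IHt] [|s] i //= st; last first.
  by move=> [m [jmi hm Hm]]; exists m; split=> //; apply: IHt Hm.
move=> ->; exists j; split; [by rewrite !leqnn | by rewrite eqxx|].
exact: (IHt 0).
Qed.

Lemma nhop_refl O t i : nhop O t i i.
Proof. exact: (@nhop_widen _ 0). Qed.

Lemma nhop1 O t i j : 0 < t -> j <= i -> j \in O i -> nhop O t i j.
Proof.
move=> t_gt0 ji jO; apply: (@nhop_widen _ 1) => //.
by exists j; split; rewrite ?ji ?leqnn ?jO ?orbT.
Qed.

Lemma nhop_shift O O' a b t i j :
    (forall l m, m < l <= b -> m \in O l -> a + m \in O' (a + l)) ->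
  i <= b -> nhop O t i j -> nhop O' t (a + i) (a + j).
Proof.
move=> OO'; elim: t i => [|t IHt] i ib /= => [->//|[m [jmi hm Hm]]].
exists (a + m); split; [lia | | by apply: IHt => //; lia].
case: (eqVneq m i) hm => [-> _|mi /= mO]; first by rewrite eqxx.
by rewrite OO' ?orbT //; lia.
Qed.

(** Induction on [t], with blocks of length [B ^ t]: one hop leads to the top of the block of [j],
    and the previous scheme works inside that block. Fewer than [B] tops lie in lower blocks. *)
Lemma digit_scheme B t : 0 < B -> exists O, scheme (B ^ t) t (t * B) O.
Proof.
move=> B_gt0; elim: t => [|t [O [sO hO]]].
  exists (fun=> [::]); split=> [//|i j /=]; rewrite expn0; lia.
set b := B ^ t in sO hO; have b_gt0 : 0 < b by rewrite expn_gt0 B_gt0.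
exists (fun i => [seq q * b + b.-1 | q <- iota 0 (i %/ b)]
              ++ [seq (i %/ b) * b + m | m <- O (i %% b)]).
split=> [i | i j]; rewrite expnS -/b => iB.
  rewrite size_cat !size_map size_iota mulSn leq_add //.
    by apply: ltnW; rewrite ltn_divLR.
  by apply: sO; rewrite ltn_mod.
have shift q l m : m <= l < b -> nhop O t l m ->
  nhop (fun i => [seq q * b + b.-1 | q <- iota 0 (i %/ b)]
              ++ [seq (i %/ b) * b + m | m <- O (i %% b)]) t
       (q * b + l) (q * b + m).
  move=> lm; apply: (@nhop_shift _ _ _ b.-1); last by lia.
  move=> l' m' lm' m'O; rewrite mem_cat divnMDl // modnMDl.
  rewrite divn_small ?modn_small ?addn0; try lia.
  by rewrite map_f ?orbT.
have jb : j %% b < b by rewrite ltn_mod.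
have ib : i %% b < b by rewrite ltn_mod.
have qb : j %/ b <= i %/ b by apply: leq_div2r; lia.
have [ij|ij] := eqVneq (i %/ b) (j %/ b).
  apply: (@nhop_widen _ t) => //.
  rewrite (divn_eq i b) (divn_eq j b) ij; apply: shift.
    by have := divn_eq i b; have := divn_eq j b; rewrite ij; lia.
  by apply: hO; have := divn_eq i b; have := divn_eq j b; rewrite ij; lia.
have qlt : j %/ b < i %/ b by lia.
have ji : (j %/ b).+1 * b <= i.
  by apply: leq_trans (leq_divM i b); rewrite leq_mul2r qlt orbT.
exists (j %/ b * b + b.-1); split.
- by have := divn_eq j b; move: ji; rewrite mulSn; lia.
- apply/orP; right; rewrite mem_cat (map_f (fun q => q * b + b.-1)) //.
  by rewrite mem_iota /= add0n.
- rewrite {2}(divn_eq j b); apply: shift; first by lia.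
  by apply: hO; lia.
Qed.

Fixpoint jsize (B H : nat) : nat :=
  if H is H'.+1 then (B * jsize B H').+1 else 1.

Lemma jsize_gt0 B H : 0 < jsize B H.
Proof. by case: H. Qed.

Lemma expn_le_jsize B H : B ^ H <= jsize B H.
Proof.
elim: H => [|H IH] //=; rewrite expnS.
by apply: leq_trans (leqnSn _); rewrite leq_mul2l IH orbT.
Qed.

(* Read downwards, the positions [jsize B H], ..., 1 are the preorder of a
   complete [B]-ary tree of height [H], and 0 is the exit just below it.  A node
   points to its children, to its later siblings and to the exits of its own
   and of its parent's subtree. *)
Lemma jump_block B H : 0 < B -> let n := jsize B H in exists O,
  [/\ size (O n) <= B.+1, (forall i, 0 < i <= n -> size (O i) <= (2 * B).+1),
      (forall j, 0 < j <= n -> nhop O H n j),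
      (forall i, i <= n -> nhop O H.+1 i 0)
    & (forall i j, 0 < j <= i -> i <= n -> nhop O (2 * H) i j)].
Proof.
move=> B_gt0 n; rewrite {}/n; elim: H => [|H [O [sr sO down up nav]]].
  exists (fun=> [:: 0]) => /=; split=> // [j|i i1|i j]; try lia.
  by exists 0; split=> //; rewrite inE orbT.
have -> : jsize B H.+1 = (B * jsize B H).+1 by [].
move: (jsize_gt0 B H) sr sO down up nav; set n := jsize B H.
move=> n_gt0 sr sO down up nav; set N := (B * n).+1.
(* The child subtrees fill the blocks from [q * n + 1] to [q.+1 * n]. For [0 < c < B], position
   [c * n] is at once the root of block [c.-1] and the exit of block [c]. So the multiples of [n]
   serve as sibling roots, own exit and, at 0, exit of the parent. *)
pose O' i := if i == N then [seq c * n | c <- iota 0 B.+1] else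
  [seq i.-1 %/ n * n + m | m <- O (i.-1 %% n).+1] ++
  (if (i.-1 %% n).+1 == n then [seq c * n | c <- iota 0 (i.-1 %/ n).+1]
   else [::]).
have O'N c : c <= B -> c * n \in O' N.
  by move=> cB; rewrite /O' eqxx (map_f (fun c => c * n)) // mem_iota.
have pos q s : 0 < s <= n -> q < B ->
    [/\ q * n + s < N, (q * n + s).-1 %/ n = q & (q * n + s).-1 %% n = s.-1].
  move=> /andP[s0 sn] qB; have -> : (q * n + s).-1 = q * n + s.-1 by lia.
  rewrite divnMDl // modnMDl divn_small ?modn_small ?addn0; try lia.
  split=> //; rewrite /N ltnS; apply: (@leq_trans (q.+1 * n)).
    by rewrite mulSn; lia.
  by rewrite leq_mul2r qB orbT.
have dec i : 0 < i < N -> exists q s, [/\ i = q * n + s, 0 < s <= n & q < B].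
  move=> iN; exists (i.-1 %/ n), (i.-1 %% n).+1; split.
  - by have := divn_eq i.-1 n; lia.
  - by rewrite ltn_mod.
  - by rewrite ltn_divLR //; move: iN; rewrite /N; lia.
have O'root q c : q < B -> c <= q -> c * n \in O' (q.+1 * n).
  move=> qB cq; have [] := pos q n _ qB; first by lia.
  rewrite -mulSnr => lN dq mq; rewrite /O' ifN; last by lia.
  rewrite dq mq prednK // eqxx mem_cat.
  by rewrite (map_f (fun c => c * n)) ?orbT // mem_iota.
have shift q t l m : q < B -> l <= n -> nhop O t l m ->
    nhop O' t (q * n + l) (q * n + m).
  move=> qB; apply: nhop_shift => l' m' lm' m'O.
  have [|lN dq mq] := pos q l' _ qB; first by lia.
  rewrite /O' ifN; last by lia.
  by rewrite dq mq prednK ?mem_cat ?map_f //; lia.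
have rootE q : q.+1 * n = q * n + n by rewrite mulSnr.
have hroot c t : c <= B -> 0 < t -> nhop O' t N (c * n).
  move=> cB t0; apply: nhop1 (O'N _ cB) => //.
  by apply: leqW; rewrite leq_mul2r cB orbT.
exists O'; split=> [|i iN|j jN|i iN|i j ji iN].
- by rewrite /O' eqxx size_map size_iota.
- have [->|iN'] := eqVneq i N.
    by rewrite /O' eqxx size_map size_iota; lia.
  have [|q [s [iE s_n qB]]] := dec i; first by lia.
  have [lN dq mq] := pos q s s_n qB.
  rewrite /O' ifN ?iE ?dq ?mq ?size_cat ?size_map; last by lia.
  rewrite prednK; last by lia.
  (* Only child roots gain pointers: at most [B], besides the at most [B.+1] that a root already
     has. *)
  case: (eqVneq s n) => [->|_]; last by rewrite addn0 sO.
  by rewrite size_map size_iota; lia.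
- have [->|jN'] := eqVneq j N; first exact: nhop_refl.
  have [|q [s [-> s_n qB]]] := dec j; first by lia.
  rewrite -[H.+1]add1n; apply: (nhop_trans (j := q.+1 * n)).
    exact: hroot.
  by rewrite rootE; apply: shift => //; apply: down.
- have [->|i0] := posnP i; first exact: nhop_refl.
  have [->|iN'] := eqVneq i N; first by rewrite -(mul0n n); apply: hroot.
  have [|q [s [-> s_n qB]]] := dec i; first by lia.
  (* The exit [q * n] is either 0 or a child root, and child roots point to 0. *)
  have Hup : nhop O' H.+1 (q * n + s) (q * n).
    by rewrite -[X in nhop _ _ _ X]addn0; apply: shift; [|lia|apply: up; lia].
  rewrite -addn1; apply: nhop_trans Hup _.
  case: q qB => [|q] qB; first by rewrite mul0n; exact: nhop_refl.
  by apply: nhop1 => //; rewrite -(mul0n n); apply: O'root => //; lia.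
- have [iE|iN'] := eqVneq i N.
    rewrite iE; have [->|jN'] := eqVneq j N; first exact: nhop_refl.
    have [|q [s [-> s_n qB]]] := dec j; first by lia.
    apply: (@nhop_widen _ (1 + H)); first by lia.
    apply: (nhop_trans (j := q.+1 * n)); first exact: hroot.
    by rewrite rootE; apply: shift => //; apply: down.
  have [|q [s [iE s_n qB]]] := dec i; first by lia.
  have [|q' [s' [jE s'_n q'B]]] := dec j; first by lia.
  subst i j; have [qq|qq] := eqVneq q q'.
    subst q'; apply: (@nhop_widen _ (2 * H)); first by lia.
    by apply: shift => //; [lia | apply: nav; lia].
  have q'q : q' < q.
    rewrite ltn_neqAle eq_sym qq leqNgt; apply/negP => qq'.
    have : q.+1 * n <= q' * n by rewrite leq_mul2r qq' orbT.
    by rewrite mulSnr; lia.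
  (* [H.+1] hops up to the exit of the block of [i], one hop across to the root of the block of [j],
     and [H] hops down. *)
  apply: (@nhop_widen _ (H.+1 + (1 + H)%N)); first by lia.
  apply: (nhop_trans (j := q * n)).
    by rewrite -[X in nhop _ _ _ X]addn0; apply: shift; [|lia|apply: up; lia].
  apply: (nhop_trans (j := q'.+1 * n)); last first.
    by rewrite rootE; apply: shift => //; apply: down.
  have [->|qq'] := eqVneq q q'.+1; first exact: nhop_refl.
  case: q qB q'q qq' {qq s_n iN iN' ji} => // q qB q'q qq'.
  apply: nhop1 => //; last by apply: O'root; lia.
  by rewrite leq_mul2r; lia.
Qed.

(** Shifting positions by one removes the exit 0, which no descent to a positive position visits. *)
Lemma jump_scheme B H : 0 < B -> exists O, scheme (B ^ H) (2 * H) (2 * B).+1 O.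
Proof.
move=> B_gt0; have [O [_ sO _ _ nav]] := jump_block H B_gt0.
have Bn := expn_le_jsize B H.
exists (fun i => [seq m.-1 | m <- O i.+1]); split=> [i iB|i j ji].
  by rewrite size_map sO; lia.
have := nav i.+1 j.+1 _ _; move: (2 * H) => t nav'.
have {}nav' : nhop O t i.+1 j.+1 by apply: nav'; lia.
elim: t i {ji} nav' => [|t IHt] i /= => [[->//]|[[|m] [jmi hm Hm]]]; first lia.
exists m; split; [lia| |exact: IHt].
case/orP: hm => [/eqP[->]|mO]; first by rewrite eqxx.
by rewrite (map_f predn mO) orbT.
Qed.

Lemma scheme_widen h h' t t' D D' O : h' <= h -> t <= t' -> D <= D' ->
  scheme h t D O -> scheme h' t' D' O.
Proof.
move=> hh tt DD [sO hO]; split=> [i ih|i j ji].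
  by apply: leq_trans DD; apply: sO; lia.
by apply: nhop_widen tt _; apply: hO; lia.
Qed.

(** * Oriented graphs and monotone hops *)

Definition out_graph (V : finType) (Out : V -> seq V) : rel V :=
  fun x y => (x != y) && ((y \in Out x) || (x \in Out y)).

Lemma out_graph_is_graph (V : finType) (Out : V -> seq V) :
  is_graph (out_graph Out).
Proof.
by split=> [x y|x]; rewrite /out_graph ?eqxx // eq_sym orbC.
Qed.

Lemma out_graph_sym (V : finType) (Out : V -> seq V) :
  symmetric (out_graph Out).
Proof. by case: (out_graph_is_graph Out). Qed.

(** Each edge is charged to the end that points to the other one; this end lies in [H.1]. *)
Lemma card_oriented_edges (V : finType) (Out : V -> seq V) D
    (H : {set V} * {set {set V}}) :
  (forall x, size (Out x) <= D) -> subgraph (out_graph Out) H ->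
  #|H.2| <= D * #|H.1|.
Proof.
move=> sD /andP[/subsetP sH /forall_inP fH].
pose s := flatten [seq [seq [set x; y] | y <- Out x] | x <- enum H.1].
have sub : {subset H.2 <= s}.
  move=> f fH2; have /imsetP[[x y] /= gxy fE] := sH _ fH2.
  move: gxy; rewrite inE /= => /andP[_ /orP xy].
  have := fH _ fH2; rewrite fE => /subsetP xyH.
  have xH : x \in H.1 by apply: xyH; rewrite !inE eqxx.
  have yH : y \in H.1 by apply: xyH; rewrite !inE eqxx orbT.
  apply/flattenP; case: xy => xy.
    exists [seq [set x; y] | y <- Out x]; last exact: map_f.
    by apply: map_f; rewrite mem_enum.
  exists [seq [set y; x] | x <- Out y]; last by rewrite setUC; apply: map_f.
  by apply: (map_f (fun y => [seq [set y; x] | x <- Out y])); rewrite mem_enum.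
apply: (@leq_trans (size s)).
  by apply: leq_trans (card_size s); apply/subset_leq_card/subsetP.
rewrite /s size_flatten /shape -map_comp sumnE big_map big_enum /=.
rewrite mulnC -sum_nat_const; apply: leq_sum => x _.
by rewrite size_map.
Qed.

(** The factor 2 comes from [#|H.1| <= 2 * (#|H.1| - 1)], valid from two vertices on. *)
Lemma arboricity_out_graph (V : finType) (Out : V -> seq V) D :
  (forall x, size (Out x) <= D) -> arboricity (out_graph Out) <= 2 * D.
Proof.
move=> sD; apply/bigmax_leqP => H /andP[sH H2].
have := card_oriented_edges sD sH; rewrite /ceil_div.
case: #|H.1| H2 => [|[|h]] // _; move: #|H.2| => m mD; rewrite subn1 /=.
have : D * h.+2 <= 2 * D * h.+1 by rewrite (mulnC 2) -mulnA leq_mul2l; lia.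
move=> mD2; rewrite -ltnS ltn_divLR // mulSn; lia.
Qed.

Lemma arboricity_card1 (V : finType) (g : rel V) :
  #|V| <= 1 -> arboricity g = 0.
Proof.
move=> V1; apply/eqP; rewrite -leqn0; apply/bigmax_leqP => H /andP[_ H2].
by have := leq_trans H2 (leq_trans (max_card _) V1).
Qed.

(** * Hop walks along geodesics of a metric *)

Definition is_metric (V : eqType) (d : V -> V -> nat) : Prop :=
  [/\ (forall x y, (d x y == 0) = (x == y)), (forall x y, d x y = d y x)
    & (forall x y z, d x z <= d x y + d y z)].

Definition between (V : Type) (d : V -> V -> nat) (u w v : V) : bool :=
  d u w + d w v == d u v.

(** The metric counterpart of [nhop]: every hop stays on a geodesic to [v], so the whole walk has
    length [d u v]. *)
Fixpoint reach (V : eqType) (d : V -> V -> nat) (g : rel V) (t : nat) (u v : V)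
    : Prop :=
  if t is t'.+1 then
    exists w, [/\ between d u w v, (w == u) || g u w & reach d g t' w v]
  else u = v.

Section Reach.
Variables (V : eqType) (d : V -> V -> nat).
Hypothesis d_metric : is_metric d.
Implicit Types (g : rel V) (u v w : V).

Let d_eq0 x y : (d x y == 0) = (x == y). Proof. by case: d_metric. Qed.
Let d_sym x y : d x y = d y x. Proof. by case: d_metric. Qed.
Let d_tri x y z : d x z <= d x y + d y z. Proof. by case: d_metric. Qed.
Let d_xx x : d x x = 0. Proof. by apply/eqP; rewrite d_eq0. Qed.

Lemma between_l u v : between d u u v.
Proof. by rewrite /between d_xx. Qed.

Lemma between_r u v : between d u v v.
Proof. by rewrite /between d_xx addn0. Qed.

Lemma between_sym u w v : between d u w v = between d v w u.
Proof. by rewrite /between addnC (d_sym u v) (d_sym u w) (d_sym w v). Qed.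

Lemma between_transl u x w v :
  between d u w v -> between d u x w -> between d u x v && between d x w v.
Proof.
rewrite /between => /eqP uwv /eqP uxw.
by have := d_tri x w v; have := d_tri u x v; lia.
Qed.

Lemma reach_widen g s t u v : s <= t -> reach d g s u v -> reach d g t u v.
Proof.
elim: t s u => [|t IHt] [|s] u //= st; last first.
  by move=> [w [uwv hw Hw]]; exists w; split=> //; apply: IHt Hw.
move=> ->; exists v; split; [exact: between_l | by rewrite eqxx|].
exact: (IHt 0).
Qed.

Lemma reach_trans g s t u w v : between d u w v ->
  reach d g s u w -> reach d g t w v -> reach d g (s + t) u v.
Proof.
elim: s u => [|s IHs] u /= uwv => [->//|[x [uxw hx Hx]] Hw].
have /andP[uxv xwv] := between_transl uwv uxw.
by exists x; split=> //; apply: IHs.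
Qed.

Lemma reach1 g u v : (v == u) || g u v -> reach d g 1 u v.
Proof. by move=> uv; exists v; split=> //; apply: between_r. Qed.

Lemma reach_sym g t u v : symmetric g -> reach d g t u v -> reach d g t v u.
Proof.
move=> g_sym; elim: t u => [|t IHt] u //= [w [uwv hw /IHt Hw]].
change (reach d g t.+1 v u); rewrite -addn1.
apply: (reach_trans (w := w)) => //; first by rewrite between_sym.
by apply: reach1; rewrite eq_sym g_sym.
Qed.

Lemma plength_ge u p : d u (last u p) <= plength d u p.
Proof.
elim: p u => [|x p IHp] u; rewrite /plength /= ?d_xx //.
by apply: leq_trans (d_tri u x _) _; rewrite leq_add2l; apply: IHp.
Qed.

Lemma plength_cat u p q :
  plength d u (p ++ q) = plength d u p + plength d (last u p) q.
Proof. by rewrite /plength pairmap_cat sumn_cat. Qed.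

(** A repeated vertex would close a detour of positive length, making the path longer than the
    distance. *)
Lemma geodesic_uniq g u p : irreflexive g -> path g u p ->
  plength d u p = d u (last u p) -> uniq (u :: p).
Proof.
move=> g_irr; elim: p u => [|x p IHp] u //= /andP[ux xp] pE.
have xpE : plength d x p = d x (last x p).
  apply/eqP; rewrite eqn_leq plength_ge andbT.
  move: pE (d_tri u x (last x p)); rewrite {1}/plength /=.
  by rewrite -/(plength d x p); lia.
have /= -> := IHp _ xp xpE; rewrite andbT; apply/negP => upx.
have [p1 [p2 pq]] : exists p1 p2, x :: p = p1 ++ u :: p2.
  by case/splitPr: upx => p1 p2; exists p1, p2.
have uNx : u != x by apply/eqP => uxE; move: ux; rewrite uxE g_irr.
have lastE : last u p2 = last x p.
  by rewrite -[last x p]/(last u (x :: p)) pq last_cat.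
have : 0 < plength d u (rcons p1 u).
  have : d u x <= plength d u (rcons p1 u).
    case: p1 pq => [[xu _]|y p1 [<- _]]; first by rewrite xu eqxx in uNx.
    by rewrite /plength /=; apply: leq_addr.
  by apply: leq_trans; rewrite lt0n d_eq0.
have := plength_ge u p2.
move: pE; rewrite pq -cat_rcons plength_cat last_rcons lastE /=; lia.
Qed.

Lemma reach_path g t u v : irreflexive g -> reach d g t u v ->
  exists p, [/\ path g u p /\ last u p = v, uniq (u :: p), size p <= t
              & plength d u p = d u v].
Proof.
move=> g_irr uv; suff [p [gp lp sp pE]] : exists p,
    [/\ path g u p, last u p = v, size p <= t & plength d u p = d u v].
  by exists p; split=> //; apply: geodesic_uniq gp _; rewrite ?lp.
elim: t u uv => [|t IHt] u /= => [->|[w [uwv hw /IHt[p [gp lp sp pE]]]]].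
  by exists [::]; split=> //; rewrite d_xx.
have [<-|wu] := eqVneq w u; first by exists p; split=> //; apply: leqW.
exists (w :: p); split=> //=; first by move: hw; rewrite (negPf wu) /= => ->.
by rewrite /plength /= -/(plength d w p) pE; apply/eqP.
Qed.

Lemma iter_fix (f : V -> V) x i j : f (iter i f x) = iter i f x -> i <= j ->
  iter j f x = iter i f x.
Proof.
move=> fx /subnK <-; rewrite iterD; elim: (j - i) => //= k ->; exact: fx.
Qed.

(** * Record maps and the lifting of schemes *)

Definition geodesic_step (g : V -> V) : Prop :=
  forall u i j, i <= j -> between d u (iter i g u) (iter j g u).

(** The horizon [N] keeps the search finite; a vertex whose search fails becomes a fixed point. *)
Definition next_record (N : nat) (phi : V -> nat) (g : V -> V) (y : V) : V :=
  let a i := phi y < phi (iter i g y) in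
  if has a (iota 0 N) then iter (find a (iota 0 N)) g y else y.

Section Record.
Variables (N : nat) (phi : V -> nat) (g : V -> V).
Let f := next_record N phi g.

Lemma next_record_gt y : f y <> y -> phi y < phi (f y).
Proof.
rewrite /f /next_record; case: ifP => // hasN _.
have := nth_find 0 hasN; rewrite nth_iota ?add0n //.
by move: hasN; rewrite has_find size_iota.
Qed.

Lemma next_record_iter y : exists b, f y = iter b g y.
Proof. by rewrite /f /next_record; case: ifP => _; [eexists|exists 0]. Qed.

Lemma next_recordE y j : j < N -> phi y < phi (iter j g y) -> exists b,
  [/\ f y = iter b g y, 0 < b <= j, phi y < phi (f y)
    & forall i, i < b -> phi (iter i g y) <= phi y].
Proof.
move=> jN yj; set a := fun i => phi y < phi (iter i g y).
have hasN : has a (iota 0 N).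
  by apply/hasP; exists j; rewrite ?mem_iota.
have fN : find a (iota 0 N) < N by move: hasN; rewrite has_find size_iota.
have before i : i < find a (iota 0 N) -> phi (iter i g y) <= phi y.
  move=> iF; have := before_find 0 iF.
  by rewrite nth_iota ?add0n /a; lia.
have := nth_find 0 hasN; rewrite nth_iota ?add0n // => aF.
have fE : f y = iter (find a (iota 0 N)) g y by rewrite /f /next_record hasN.
exists (find a (iota 0 N)); split=> //; last by rewrite fE.
apply/andP; split.
  by rewrite lt0n; apply/eqP => F0; move: aF; rewrite F0 /a ltnn.
by rewrite leqNgt; apply/negP => /before; lia.
Qed.

(** Strong induction on the window: either [u] is already a maximum, or one hops to the first larger
    value, skipping only values at most [phi u], and recurses on the rest of the window. *)
Lemma record_max u s : s < N -> exists a i,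
  [/\ iter a f u = iter i g u, i <= s
    & forall j, j <= s -> phi (iter j g u) <= phi (iter i g u)].
Proof.
elim: s {-2}s (leqnn s) u => [|m IHm] s sm u sN.
  by exists 0, 0; split=> // j js; have -> : j = 0 by lia.
have [/hasP[j]|none] :=
    boolP (has (fun j => phi u < phi (iter j g u)) (iota 0 s.+1)); last first.
  exists 0, 0; split=> // j js; rewrite leqNgt; apply/negP => uj.
  by case/hasP: none; exists j; rewrite ?mem_iota.
rewrite mem_iota add0n => js uj.
have [|b [fE bj ub bmax]] := @next_recordE u j _ uj; first by lia.
have [||a [i [aE i_s imax]]] := IHm (s - b) _ (f u); [lia|lia|].
exists a.+1, (i + b); split; [by rewrite iterSr aE fE iterD | lia|].
move=> l ls; rewrite iterD -fE; have [lb|bl] := ltnP l b.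
  have := bmax l lb; have := imax 0 isT; rewrite /=; lia.
by have := imax (l - b); rewrite fE -iterD subnK //; apply; lia.
Qed.
End Record.

Section Lift.
Variables (h t D : nat) (O : nat -> seq nat) (f : V -> V) (phi : V -> nat).
Hypothesis f_phi : forall y, f y <> y -> phi y < phi (f y).
Hypothesis phi_lt : forall y, phi y < h.
Hypothesis f_geodesic : geodesic_step f.
Hypothesis O_scheme : scheme h t D O.

Let fixed x i := f (iter i f x) == iter i f x.

(** Until a fixed point is met [phi] grows strictly, and it stays below [h]. *)
Let fixed_lt x : exists2 i, i < h & fixed x i.
Proof.
have [/hasP[i]|none] := boolP (has (fixed x) (iota 0 h)).
  by rewrite mem_iota; exists i.
have incr i : i <= h -> i <= phi (iter i f x).
  elim: i => // i IHi ih; apply: leq_ltn_trans (IHi (ltnW ih)) _.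
  by apply: f_phi => /eqP fix_i; case/hasP: none; exists i; rewrite ?mem_iota.
by have := incr h (leqnn h); have := phi_lt (iter h f x); lia.
Qed.

Let fixed_ex x : exists i, fixed x i.
Proof. by have [i _ fi] := fixed_lt x; exists i. Qed.

Let depth x := ex_minn (fixed_ex x).

Let depth_lt x : depth x < h.
Proof.
rewrite /depth; case: ex_minnP => m _ mP; have [i ih /mP] := fixed_lt x.
by move/leq_ltn_trans; apply.
Qed.

Let depth_f x : depth (f x) = (depth x).-1.
Proof.
rewrite /depth; case: ex_minnP => m fm mP; case: ex_minnP => l fl lP.
have : l <= m.+1 by apply: lP; rewrite /fixed !iterSr.
case: l {lP} fl => [fx|l fl] lm; last first.
  by apply/eqP; rewrite eqn_leq -(ltnS l) lm andbT mP // /fixed -iterSr.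
by apply/eqP; rewrite -leqn0 mP // /fixed /= (eqP fx).
Qed.

Let depth_iter i x : depth (iter i f x) = depth x - i.
Proof. by elim: i => [|i IHi] /=; rewrite ?subn0 // depth_f IHi subnS. Qed.

Let iter_depth i x : depth x <= i -> iter i f x = iter (depth x) f x.
Proof.
by apply: iter_fix; apply/eqP; rewrite /depth; case: ex_minnP.
Qed.

(** Each [x] plays the integer [depth x], its number of [f]-steps to a fixed point, and a pointer to
    [j] becomes the iterate of depth [j]. Quantifying over [G] lets several pointer families share
    one graph. *)
Lemma lift_scheme : exists Out : V -> seq V,
  (forall x, size (Out x) <= D) /\
  forall G : rel V, (forall x y, y \in Out x -> y != x -> G x y) ->
  forall u s, reach d G t u (iter s f u).
Proof.
have [sO hO] := O_scheme.
exists (fun x => [seq iter (depth x - j) f x | j <- O (depth x)]).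
split=> [x|G outG u s]; first by rewrite size_map sO.
(* From step [depth u] on the iterates are constant. *)
wlog su : s / s <= depth u => [wl|].
  have [/wl//|/ltnW us] := leqP s (depth u).
  by rewrite iter_depth //; apply: wl.
have : nhop O t (depth u) (depth u - s) by apply: hO; rewrite leq_subr /=.
elim: (t) u s su => [|r IHr] u s su /=.
  by move=> us; have -> : s = 0 by lia.
move=> [m [jmi hm Hm]]; exists (iter (depth u - m) f u); split.
- by apply: f_geodesic; lia.
- case: eqVneq => //= ne; apply: outG => //.
  case/orP: hm => [/eqP mE|mO]; last exact: map_f.
  by rewrite mE subnn eqxx in ne.
- have dm : depth (iter (depth u - m) f u) = m by rewrite depth_iter; lia.
  have -> : iter s f u = iter (m - (depth u - s)) f (iter (depth u - m) f u).
    by rewrite -iterD; congr iter; lia.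
  apply: IHr; rewrite dm; first by lia.
  by have -> : m - (m - (depth u - s)) = depth u - s by lia.
Qed.
End Lift.

Lemma geodesic_step_iterates (f g : V -> V) : geodesic_step g ->
  (forall y, exists b, f y = iter b g y) -> geodesic_step f.
Proof.
move=> gg fg u i j /subnK <-; move: (j - i) => k.
have fgi l y : exists b, iter l f y = iter b g y.
  elim: l => [|l [b IHl]]; first by exists 0.
  by have [c fc] := fg (iter b g y); exists (c + b); rewrite iterD /= IHl.
rewrite iterD; have [b ->] := fgi i u; have [c ->] := fgi k (iter b g u).
by rewrite -iterD; apply: gg; lia.
Qed.

(** A chain of records has fewer than [h] steps however long the orbit of [g] is, so a scheme on the
    integers below [h] suffices for every climb. *)
Lemma record_leg h t D O N (g : V -> V) (phi : V -> nat) :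
  geodesic_step g -> (forall y, phi y < h) ->
  scheme h t D O -> exists Out : V -> seq V,
  (forall x, size (Out x) <= D) /\
  forall G : rel V, (forall x y, y \in Out x -> y != x -> G x y) ->
  forall u s, s < N -> exists i,
    [/\ i <= s, forall j, j <= s -> phi (iter j g u) <= phi (iter i g u)
      & reach d G t u (iter i g u)].
Proof.
move=> gg phi_lt hO; pose f := next_record N phi g.
have [|Out [sOut hOut]] := lift_scheme (@next_record_gt N phi g) phi_lt _ hO.
  by apply: geodesic_step_iterates gg _ => y; apply: next_record_iter.
exists Out; split=> // G outG u s sN.
have [a [i [aE i_s imax]]] := record_max phi g u sN.
by exists i; split=> //; rewrite -aE; apply: hOut.
Qed.
End Reach.

(** * Rooted trees *)

Section Gdist.
Variables (V : finType) (e : rel V).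
Local Notation d := (gdist e).

Lemma has_walkP x y l :
  reflect (exists p, [/\ path e x p, last x p = y & size p = l])
          (has_walk e x y l).
Proof.
apply: (iffP existsP) => [[p /andP[ep /eqP lp]]|[p [ep lp sp]]].
  by exists p; rewrite size_tuple.
have sp' : size p == l by rewrite sp.
by exists (Tuple sp') => /=; rewrite ep lp eqxx.
Qed.

Lemma gdist_le x p : path e x p -> d x (last x p) <= size p.
Proof.
(* For a walk of at least [#|V|] edges the bound holds because [find] never exceeds the length of
   its list. *)
move=> ep; have [pV|Vp] := ltnP (size p) #|V|; last first.
  by apply: leq_trans Vp; rewrite -[X in _ <= X](size_iota 0) find_size.
rewrite leqNgt; apply/negP => /(before_find 0).
by rewrite nth_iota // => /has_walkP[]; exists p.
Qed.

Hypotheses (e_sym : symmetric e) (e_conn : forall x y, connect e x y).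

Lemma gdist_lt x y : d x y < #|V|.
Proof.
have /connectP[p ep ->] := e_conn x y; case: (shortenP ep) => p' ep' up' _.
apply: leq_ltn_trans (gdist_le ep') _.
by have := card_uniqP up' => /= <-; apply: max_card.
Qed.

Lemma gdist_walk x y :
  exists p, [/\ path e x p, last x p = y & size p = d x y].
Proof.
have hasV : has (has_walk e x y) (iota 0 #|V|).
  by rewrite has_find size_iota; apply: gdist_lt.
have := nth_find 0 hasV; rewrite nth_iota ?add0n; first by move/has_walkP.
exact: gdist_lt.
Qed.

Lemma gdist_edge x y : e x y -> d x y <= 1.
Proof. by move=> xy; apply: (gdist_le (p := [:: y])); rewrite /= xy. Qed.

Lemma gdist_metric : is_metric d.
Proof.
have d_sym x y : d x y <= d y x.
  have [p [ep lp <-]] := gdist_walk y x.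
  have lr : last x (rev (belast y p)) = y.
    by case: p lp {ep} => [|z p] //= lp; rewrite rev_cons last_rcons.
  rewrite -{1}lr -(size_belast y p) -size_rev; apply: gdist_le.
  by rewrite -{1}lp rev_path (eq_path (e' := e)) // => a b; rewrite e_sym.
split=> [x y|x y|x y z]; last 2 first.
- by apply/eqP; rewrite eqn_leq !d_sym.
- have [p [ep lp <-]] := gdist_walk x y; have [q [eq lq <-]] := gdist_walk y z.
  rewrite -size_cat -lq -lp -last_cat; apply: gdist_le.
  by rewrite cat_path ep lp eq.
apply/eqP/eqP => [xy0|->]; last first.
  by apply/eqP; rewrite -leqn0; apply: (gdist_le (p := [::])).
by have [[|? ?] [_ //= ? /eqP]] := gdist_walk x y; rewrite xy0.
Qed.

End Gdist.

(** * Parents, ancestors, lowest common ancestors and components *)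

Section RootedTree.
Variables (V : finType) (e : rel V) (r : V).
Hypothesis e_tree : is_tree e.
Local Notation d := (gdist e).

Let e_sym : symmetric e. Proof. by case: e_tree => -[]. Qed.
Let e_irr : irreflexive e. Proof. by case: e_tree => -[]. Qed.
Let e_conn x y : connect e x y. Proof. by case: e_tree. Qed.

Lemma tree_metric : is_metric d.
Proof. exact: gdist_metric. Qed.

Let d_eq0 x y : (d x y == 0) = (x == y). Proof. by case: tree_metric. Qed.
Let d_sym x y : d x y = d y x. Proof. by case: tree_metric. Qed.
Let d_tri x y z : d x z <= d x y + d y z. Proof. by case: tree_metric. Qed.
Let d_xx x : d x x = 0. Proof. by apply/eqP; rewrite d_eq0. Qed.

Definition dep (v : V) : nat := d r v.

(** The default [v] is taken at the root only. *)
Definition par (v : V) : V := odflt v [pick y | e v y && ((dep y).+1 == dep v)].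

Lemma dep_eq0 v : (dep v == 0) = (v == r).
Proof. by rewrite /dep d_eq0 eq_sym. Qed.

Lemma par_root : par r = r.
Proof. by rewrite /par; case: pickP => //= y /andP[_]; rewrite /dep d_xx. Qed.

Lemma par_edge v : v != r -> e v (par v) /\ (dep (par v)).+1 = dep v.
Proof.
move=> vr; rewrite /par; case: pickP => [y /andP[? /eqP]//|none].
have [p [ep lp sp]] := gdist_walk e_conn r v.
case/lastP: p ep lp sp => [_ /= rv|p x]; first by rewrite rv eqxx in vr.
rewrite rcons_path last_rcons size_rcons => /andP[ep ex] xv; subst x => sp.
have := none (last r p); rewrite e_sym ex /= /dep -sp eqSS.
have -> // : d r (last r p) == size p.
rewrite eqn_leq gdist_le //= -ltnS sp (leq_trans (d_tri _ (last r p) _)) //.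
by rewrite -addn1 leq_add2l gdist_edge.
Qed.

Lemma dep_par v : dep (par v) = (dep v).-1.
Proof.
have [->|vr] := eqVneq v r; first by rewrite par_root /dep d_xx.
by have [_ <-] := par_edge vr.
Qed.

(* Deleting an edge of a tree separates its ends, whereas the parent edges
   alone connect every vertex to the root. *)
Lemma edge_par x y : e x y -> par x = y \/ par y = x.
Proof.
move=> xy; have [|pxy] := eqVneq (par x) y; first by left.
have [|pyx] := eqVneq (par y) x; first by right.
pose e' : rel V := fun a b =>
  [&& e a b, (a, b) != (x, y) & (a, b) != (y, x)].
have e'_sym : connect_sym e'.
  apply: sym_connect_sym => a b; rewrite /e' e_sym -!pair_eqE /pair_eq /=.
  by congr (_ && _); rewrite andbC [(a == y) && _]andbC [(a == x) && _]andbC.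
have to_root v : connect e' v r.
  elim: {v}(dep v) {-2}v (erefl (dep v)) => [|n IHn] v vn.
    by have /eqP -> : v == r by rewrite -dep_eq0 vn.
  have vr : v != r by rewrite -dep_eq0 vn.
  have [ev pn] := par_edge vr.
  apply: connect_trans (IHn (par v) _); last by rewrite dep_par vn.
  apply: connect1; rewrite /e' ev -!pair_eqE /pair_eq /=.
  by apply/andP; split; apply/negP => /andP[/eqP->];
    rewrite (negPf pxy, negPf pyx).
have xy' : connect e' x y.
  by apply: connect_trans (to_root x) _; rewrite e'_sym; apply: to_root.
have [_ _ _ acyc] := e_tree.
have /connectP[p0 ep0 yE] := xy'; case: (shortenP ep0) yE => p ep up _ yE.
have e'e : path e x p by apply: sub_path ep => a b /and3P[].
(* A simple path from [x] to [y] avoiding the edge [xy] has at least two edges, and this edge closes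
   it to a cycle. *)
case: p ep up yE e'e => [|z [|z' p]] ep up yE e'e.
- by move: xy; rewrite yE /= e_irr.
- by move: ep; rewrite /= /e' yE /= eqxx andbF.
- by case: (acyc [:: x, z, z' & p]) => //; rewrite /ucycle up andbT
    /cycle rcons_path e'e -yE e_sym.
Qed.

(** A step down followed by a step up cancels, so every walk reduces to an ascent followed by a
    descent. *)
Lemma walk_up_down u p : path e u p -> exists i j,
  i + j <= size p /\ iter i par u = iter j par (last u p).
Proof.
elim: p u => [|y p IHp] u /=; first by exists 0, 0.
move=> /andP[uy /IHp[i [j [ijp ij]]]].
have [uy'|yu] := edge_par uy.
  by exists i.+1, j; rewrite iterSr uy'.
case: i ijp ij => [|i] ijp ij; last first.
  by exists i, j; split; [lia|rewrite -ij iterSr yu].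
by exists 0, j.+1; split; [lia|rewrite /= -ij /= yu].
Qed.

Lemma dep_iter i u : dep (iter i par u) = dep u - i.
Proof. by elim: i => [|i IHi] /=; rewrite ?subn0 // dep_par IHi subnS. Qed.

Lemma iter_root i u : dep u <= i -> iter i par u = r.
Proof. by move=> ui; apply/eqP; rewrite -dep_eq0 dep_iter subn_eq0. Qed.

Lemma dist_iter i u : d u (iter i par u) = dep u - dep (iter i par u).
Proof.
wlog iu : i / i <= dep u => [wl|].
  have [/wl//|/ltnW ui] := leqP i (dep u).
  by rewrite (iter_root ui) -(iter_root (leqnn (dep u))) wl.
have d1 v : d v (par v) <= 1.
  have [->|/par_edge[/gdist_edge]//] := eqVneq v r.
  by rewrite par_root d_xx.
have di : d u (iter i par u) <= i.
  elim: {iu}i => [|i IHi] /=; first by rewrite d_xx.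
  by apply: leq_trans (d_tri _ (iter i par u) _) _; rewrite -addn1 leq_add.
have := d_tri r (iter i par u) u; rewrite -!/(dep _) dep_iter (d_sym _ u); lia.
Qed.

Definition anc (a u : V) : bool := iter (dep u - dep a) par u == a.

Lemma anc_iter i u : anc (iter i par u) u.
Proof.
rewrite /anc dep_iter; have [iu|/ltnW ui] := leqP i (dep u).
  by rewrite subKn.
by rewrite (iter_root ui) iter_root //; lia.
Qed.

Lemma ancE a u : anc a u -> a = iter (dep u - dep a) par u.
Proof. by move/eqP. Qed.

Lemma anc_refl u : anc u u.
Proof. exact: (anc_iter 0). Qed.

Lemma anc_dep a u : anc a u -> dep a <= dep u.
Proof. by move/ancE->; rewrite dep_iter leq_subr. Qed.

Lemma anc_dist a u : anc a u -> d u a = dep u - dep a.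
Proof. by move=> au; rewrite (ancE au) dist_iter. Qed.

Lemma anc_trans b a u : anc a b -> anc b u -> anc a u.
Proof. by move=> /ancE-> /ancE->; rewrite -iterD; apply: anc_iter. Qed.

Lemma anc_dep_le a b u : anc a u -> anc b u -> dep a <= dep b -> anc a b.
Proof.
move=> au bu ab; rewrite (ancE au); have bu' := anc_dep bu.
have -> : dep u - dep a = (dep b - dep a) + (dep u - dep b) by lia.
by rewrite iterD -(ancE bu) anc_iter.
Qed.

Lemma anc_dep_eq a b u : anc a u -> anc b u -> dep a = dep b -> a = b.
Proof. by move=> /ancE au /ancE bu ab; rewrite au bu ab. Qed.

Lemma anc_root u : anc r u.
Proof. by rewrite -(iter_root (leqnn (dep u))) anc_iter. Qed.

(** [w] is the top of a shortest walk after reduction to an ascent and a descent. A deeper common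
    ancestor would give a shorter way. *)
Lemma lca u v : exists w, [/\ anc w u, anc w v,
  d u v = (dep u - dep w) + (dep v - dep w)
  & forall z, anc z u -> anc z v -> anc z w].
Proof.
have [p [ep lp sp]] := gdist_walk e_conn u v.
have [i [j [ijp]]] := walk_up_down ep; rewrite lp => ij.
set w := iter i par u in ij *.
have wu : anc w u by apply: anc_iter.
have wv : anc w v by rewrite ij; apply: anc_iter.
have duv : d u v = (dep u - dep w) + (dep v - dep w).
  have := d_tri u w v; rewrite (d_sym w v) (anc_dist wu) (anc_dist wv).
  have : dep w = dep v - j by rewrite ij dep_iter.
  have := dep_iter i u; rewrite -/w; lia.
exists w; split=> // z zu zv.
apply: (anc_dep_le zu wu); rewrite leqNgt; apply/negP => wz.
have := d_tri u z v; rewrite (d_sym z v) (anc_dist zu) (anc_dist zv) duv.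
have := anc_dep zu; have := anc_dep zv; lia.
Qed.

Lemma par_geodesic : geodesic_step d par.
Proof.
move=> u i j /subnK <-; move: (j - i) => k; rewrite /between.
have := dist_iter (k + i) u; have := dist_iter k (iter i par u).
by have := dist_iter i u; rewrite iterD !dep_iter => -> -> ->; apply/eqP; lia.
Qed.

Definition sub (v : V) : {set V} := [set w | anc v w].

Lemma sub_anc a u : anc a u -> sub u \subset sub a.
Proof.
by move=> au; apply/subsetP => w; rewrite !inE; apply: anc_trans au.
Qed.

(* A label for the component of [u] in the tree minus [c]; [c] itself gets the
   junk label [Some c]. *)
Definition component (c u : V) : option V :=
  if anc c u then Some (iter (dep u - dep c).-1 par u) else None.

(** Different labels force [c] to be an ancestor of [u], say. If it is also one of [v], it must be
    their lowest common ancestor [w], since otherwise both lie below the same child of [c]. If not,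
    [c] lies strictly below [w] on the way up from [u]. *)
Lemma component_between c u v : component c u != component c v ->
  between d u c v.
Proof.
have [w [wu wv duv wmax]] := lca u v; rewrite /between duv (d_sym c v).
have wu' := anc_dep wu; have wv' := anc_dep wv.
wlog cu : u v wu wv duv wmax wu' wv' / anc c u.
  move=> wl; case cu: (anc c u); first exact: wl.
  case cv: (anc c v); last by rewrite /component cu cv.
  rewrite eq_sym => vu; rewrite addnC [X in _ == X]addnC; apply: wl => //.
    by rewrite d_sym duv addnC.
  by move=> z zv zu; apply: wmax.
rewrite (anc_dist cu); have cu' := anc_dep cu; case cv: (anc c v).
  have cw := wmax c cu cv; rewrite (anc_dist cv).
  have cw' := anc_dep cw; have [<-|cw_dep] := eqVneq (dep c) (dep w) => //.
  rewrite /component cu cv.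
  have up x : anc w x -> iter (dep x - dep c).-1 par x
                       = iter (dep w - dep c).-1 par w.
    move=> wx; have := anc_dep wx => wx'.
    rewrite [X in _ = iter _ _ X](ancE wx) -iterD; congr iter; lia.
  by rewrite !up ?eqxx.
move=> _; have wc : dep w < dep c.
  rewrite ltnNge; apply/negP => cw; have cw' := anc_dep_le cu wu cw.
  by rewrite (anc_trans cw' wv) in cv.
have wac : anc w c by apply: anc_dep_le wu cu (ltnW wc).
have := d_tri c w v; have := d_tri u c v.
rewrite duv (anc_dist cu) (d_sym c v) (d_sym w v) (anc_dist wac) (anc_dist wv).
lia.
Qed.
End RootedTree.

(** * Centroids *)

Section Centroid.
Variables (V : finType) (e : rel V) (r : V).
Hypothesis e_tree : is_tree e.
Local Notation d := (gdist e).
Local Notation dep := (dep e r).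
Local Notation anc := (anc e r).
Local Notation sub := (sub e r).
Local Notation component := (component e r).

Definition part (S : {set V}) (c u : V) : {set V} :=
  [set w in S | component c w == component c u].

Definition is_centroid (S : {set V}) (c : V) : bool :=
  [forall u in S, (u != c) ==> (2 * #|part S c u| <= #|S|)].

(** Take the deepest [c] whose subtree holds more than half of [S]: no child subtree holds more than
    half, and less than half is left outside. The vertex [c] may lie outside [S]. *)
Lemma centroid_exists S : exists c, is_centroid S c.
Proof.
have [->|/set0Pn[u0 u0S]] := eqVneq S set0.
  by exists r; apply/forall_inP => u; rewrite inE.
pose big c := #|S| < 2 * #|S :&: sub c|.
have big_r : big r.
  rewrite /big (_ : S :&: sub r = S); last first.
    by apply/setP => w; rewrite !inE anc_root ?andbT.
  by have : 0 < #|S| by [apply/card_gt0P; exists u0]; lia.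
case: (@arg_maxnP _ r big dep big_r) => c big_c cmax.
exists c; apply/forall_inP => u uS; apply/implyP => uc.
rewrite /part /component; case cu: (anc c u); last first.
  apply: (@leq_trans (2 * #|S :\: sub c|)); last first.
    by have := cardsID (sub c) S; move: big_c; rewrite /big; lia.
  rewrite leq_mul2l /=; apply/subset_leq_card/subsetP => w.
  by rewrite !inE => /andP[->]; case: (anc c w).
set x := iter _ _ u.
have cu' := anc_dep e_tree cu.
have cu_dep : dep c < dep u.
  rewrite ltn_neqAle cu' andbT; apply: contraNneq uc => cuE.
  by rewrite (anc_dep_eq cu (anc_refl r e_tree u) cuE).
have dx : dep x = (dep c).+1 by rewrite /x dep_iter //; lia.
have : ~~ big x by apply/negP => /cmax /=; rewrite dx ltnn.
rewrite /big -leqNgt; apply: leq_trans; rewrite leq_mul2l /=.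
apply/subset_leq_card/subsetP => w; rewrite !inE => /andP[->].
by case: (anc c w) => //= /eqP[<-]; apply: anc_iter.
Qed.

Definition centroid (S : {set V}) : V := xchoose (centroid_exists S).

Fixpoint centroids (m : nat) (S : {set V}) (u : V) : seq V :=
  if m is m'.+1 then
    centroid S :: centroids m' (part S (centroid S) u) u
  else [::].

Lemma size_centroids m (S : {set V}) u : size (centroids m S u) = m.
Proof. by elim: m S => //= m IHm S; rewrite IHm. Qed.

(** While the centroid is not between [u] and [v], both stay in the same part, of at most half the
    size; this can last fewer than [m] levels. *)
Lemma centroids_between m (S : {set V}) u v :
  #|S| < 2 ^ m -> u \in S -> v \in S ->
  exists c, [/\ c \in centroids m S u, c \in centroids m S v & between d u c v].
Proof.
elim: m S => [|m IHm] S Sm uS vS.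
  move: Sm; rewrite expn0 ltnS leqn0 cards_eq0 => /eqP S0.
  by rewrite S0 inE in uS.
rewrite /=; set c := centroid S; have cS : is_centroid S c := xchooseP _.
have [ucv|nucv] := boolP (between d u c v).
  by exists c; rewrite !mem_head.
have uc : u != c.
  apply: contraNneq nucv => ->; exact: between_l (tree_metric e_tree) _ _.
have uv : component c u = component c v.
  by apply/eqP; apply: contraNT nucv; apply: component_between.
have partE : part S c v = part S c u by rewrite /part uv.
have [||| c' [c'u c'v uc'v]] := IHm (part S c u).
- have := implyP (forall_inP cS u uS) uc; move: Sm; rewrite expnS; lia.
- by rewrite inE uS eqxx.
- by rewrite inE vS uv eqxx.
by exists c'; rewrite partE !inE c'u c'v !orbT.
Qed.

Lemma centroid_shortcut : let h := (trunc_log 2 #|V|).+1 in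
  exists Out : V -> seq V, (forall x, size (Out x) <= h) /\
  forall u v, reach d (out_graph Out) 2 u v.
Proof.
move=> h; exists (centroids h setT).
split=> [x|u v]; first by rewrite size_centroids.
have [|||c [cu cv ucv]] := @centroids_between h setT u v; rewrite ?inE //.
  by rewrite cardsT trunc_log_ltn.
have m := tree_metric e_tree.
apply: (@reach_trans _ _ m _ 1 1 _ _ _ ucv); apply: reach1 => //.
  by rewrite /out_graph cu eq_sym /=; case: eqVneq.
by rewrite /out_graph cv orbT eq_sym andbT orbN.
Qed.

End Centroid.

(** * Height *)

Section Height.
Variables (V : finType) (e : rel V) (r : V).
Hypothesis e_tree : is_tree e.
Local Notation d := (gdist e).
Local Notation dep := (dep e r).
Local Notation anc := (anc e r).
Local Notation par := (par e r).
Local Notation sub := (sub e r).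
Let m := tree_metric e_tree.

Lemma height_shortcut h t D O : (forall v, dep v < h) -> scheme h t D O ->
  exists Out : V -> seq V, (forall x, size (Out x) <= D) /\
  forall u v, reach d (out_graph Out) (t + t) u v.
Proof.
(* This [phi] grows strictly towards the root, so on a climb from [x] to [w] its maximum is attained
   at [w] alone. *)
move=> dep_lt hO; pose phi v := h.-1 - dep v.
have [|Out [sOut hOut]] :=
    record_leg h (par_geodesic r e_tree) (phi := phi) _ hO.
  by move=> y; have := dep_lt y; rewrite /phi; lia.
exists Out; split=> // u v.
have up w x : anc w x -> reach d (out_graph Out) t x w.
  move=> wx; have wE := ancE wx.
  have [||i [i_s imax xi]] := hOut (out_graph Out) _ x (dep x - dep w).
  - by move=> y z zy yz; rewrite /out_graph zy eq_sym yz.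
  - by have := dep_lt x; lia.
  have := imax _ (leqnn _); rewrite -wE /phi dep_iter // => phi_le.
  rewrite [X in reach _ _ _ _ X]wE (_ : dep x - dep w = i) //.
  have := dep_lt w; have := dep_lt x; have := anc_dep e_tree wx; lia.
have [w [wu wv duv _]] := lca r e_tree u v.
apply: (reach_trans m (w := w)); [|exact: up|].
  rewrite /between duv (anc_dist e_tree wu).
  by case: m => _ d_sym _; rewrite d_sym (anc_dist e_tree wv).
by apply: (reach_sym m) => //; [apply: out_graph_sym | apply: up].
Qed.

End Height.

(** * Heavy paths *)

(** With [k] the common valuation, [p] is an odd multiple of [2 ^ k], so [p + 2 ^ k] has a larger
    valuation; it is at most the multiple [q], and differs from [q] by its valuation. *)
Lemma logn2_between p q : 0 < p < q -> logn 2 p = logn 2 q ->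
  exists2 l, p < l < q & logn 2 p < logn 2 l.
Proof.
move=> /andP[p0 pq] pqE; set k := logn 2 p.
have [a a_odd pE] := pfactor_coprime (isT : prime 2) p0; rewrite -/k in pE.
have k2 : 0 < 2 ^ k by rewrite expn_gt0.
have q2 : 2 ^ k %| q by rewrite pfactor_dvdn // -?pqE //; lia.
have p2 : 2 ^ k %| p by rewrite pE dvdn_mull.
have val : k < logn 2 (p + 2 ^ k).
  rewrite -pfactor_dvdn //; last by lia.
  rewrite pE -mulSnr expnS dvdn_mul // dvdn2 /= negbK.
  by rewrite coprime2n in a_odd.
exists (p + 2 ^ k) => //; apply/andP; split; first by lia.
have : p + 2 ^ k <= q.
  rewrite -leq_subRL; last by lia.
  by apply: dvdn_leq; rewrite ?dvdn_subr ?subn_gt0 //; lia.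
rewrite leq_eqVlt => /orP[/eqP pkq|//]; by move: val; rewrite pkq -pqE -/k ltnn.
Qed.

Section HeavyPath.
Variables (V : finType) (e : rel V) (r : V).
Hypothesis e_tree : is_tree e.
Local Notation d := (gdist e).
Local Notation dep := (dep e r).
Local Notation anc := (anc e r).
Local Notation par := (par e r).
Local Notation sub := (sub e r).
Let m := tree_metric e_tree.

Definition rk (v : V) : nat := trunc_log 2 #|sub v|.

Lemma rk_anc a u : anc a u -> rk u <= rk a.
Proof.
by move=> au; apply: leq_trunc_log; apply/subset_leq_card/(sub_anc e_tree).
Qed.

(** Two disjoint subtrees of size at least [2 ^ rk] would give the parent a subtree of size at least
    [2 ^ rk.+1]. *)
Lemma same_rk_child x y : x != r -> y != r -> par x = par y ->
  rk x = rk (par x) -> rk y = rk (par x) -> x = y.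
Proof.
move=> xr yr xy rx ry; apply/eqP; apply: contraT => neq.
have [_ dx] := par_edge e_tree xr; have [_ dy] := par_edge e_tree yr.
have disj : sub x :&: sub y = set0.
  apply/setP => w; rewrite !inE; apply/negP => /andP[xw yw].
  by case/eqP: neq; apply: anc_dep_eq xw yw _; rewrite -dx -dy xy.
have le : #|sub x :|: sub y| <= #|sub (par x)|.
  apply: subset_leq_card; rewrite subUset !(sub_anc e_tree) //.
    by rewrite xy; apply: (anc_iter r e_tree 1).
  exact: (anc_iter r e_tree 1).
have sub_gt0 z : 0 < #|sub z|.
  by apply/card_gt0P; exists z; rewrite inE; apply: anc_refl.
have hx := trunc_logP (isT : 1 < 2) (sub_gt0 x).
have hy := trunc_logP (isT : 1 < 2) (sub_gt0 y).
have hp := trunc_log_ltn #|sub (par x)| (isT : 1 < 2).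
move: le hx hy hp; rewrite cardsU disj cards0 -!/(rk _) rx ry expnS; lia.
Qed.

(** One step down the path of equal rank; the lower end of the path is a fixed point. *)
Definition heavy (v : V) : V :=
  odflt v [pick x | [&& x != r, par x == v & rk x == rk v]].

Lemma heavy_par x : x != r -> rk x = rk (par x) -> heavy (par x) = x.
Proof.
move=> xr rx; rewrite /heavy.
case: pickP => [y /and3P[yr /eqP py /eqP ry]|/(_ x)].
  by apply: same_rk_child => //; rewrite py.
by rewrite xr rx !eqxx.
Qed.

Lemma heavy_anc v : anc v (heavy v).
Proof.
rewrite /heavy; case: pickP => [x /and3P[_ /eqP <- _]|_ /=].
  exact: (anc_iter r e_tree 1).
exact: anc_refl.
Qed.

(** Rank is monotone along ancestors, hence constant between [w] and [x]. *)
Lemma heavy_chain w x : anc w x -> rk x = rk w ->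
  x = iter (dep x - dep w) heavy w.
Proof.
move=> wx rx; move xn: (dep x - dep w) => n.
elim: n x wx rx xn => [|n IHn] x wx rx xn.
  by have := ancE wx; rewrite xn.
have xr : x != r by rewrite -(dep_eq0 r e_tree) -lt0n; lia.
have [_ dx] := par_edge e_tree xr.
have px : anc (par x) x := anc_iter r e_tree 1 x.
have wp : anc w (par x) by apply: (anc_dep_le e_tree wx px); lia.
have rp : rk (par x) = rk w.
  by apply/eqP; rewrite eqn_leq rk_anc //= -rx rk_anc.
rewrite /= -(IHn _ wp rp); last by lia.
by rewrite heavy_par // rx rp.
Qed.

Lemma heavy_iter_anc i u : anc u (iter i heavy u).
Proof.
elim: i => [|i IHi]; first exact: anc_refl.
by apply: (anc_trans e_tree IHi); apply: heavy_anc.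
Qed.

Lemma heavy_geodesic : geodesic_step d heavy.
Proof.
move=> u i j /subnK <-; move: (j - i) => k; rewrite iterD.
have ui := heavy_iter_anc i u; have ik := heavy_iter_anc k (iter i heavy u).
have uk := anc_trans e_tree ui ik; case: m => _ d_sym _; rewrite /between.
set a := iter i _ _ in ui ik uk *; set b := iter k _ _ in ik uk *.
rewrite (d_sym u a) (d_sym u b) (d_sym a b).
rewrite (anc_dist e_tree ui) (anc_dist e_tree ik) (anc_dist e_tree uk).
by have := anc_dep e_tree ui; have := anc_dep e_tree ik; lia.
Qed.

(* The depth modulo powers of 2 plays the role of a balanced search tree on
   every heavy path at once: by [logn2_between] the maximum of [ruler] on a
   stretch of a heavy path is attained only once. *)
Definition ruler (v : V) : nat := logn 2 (dep v).+1.

Lemma log_shortcut t D O : let h := (trunc_log 2 #|V|).+1 in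
  scheme h t D O -> exists Out : V -> seq V,
  (forall x, size (Out x) <= 3 * D) /\
  forall u v, reach d (out_graph Out) (4 * t) u v.
Proof.
move=> h hO; set N := #|V|.
have dep_lt v : dep v < N by apply: gdist_lt; case: e_tree.
have rk_lt v : rk v < h by rewrite ltnS leq_trunc_log // max_card.
have ruler_lt v : ruler v < h.
  rewrite ltnS; apply: trunc_log_max => //; apply: leq_trans (dep_lt v).
  by apply: dvdn_leq => //; apply: pfactor_dvdnn.
have pg := par_geodesic r e_tree.
have [Out1 [s1 leg1]] := record_leg N pg rk_lt hO.
have [Out2 [s2 leg2]] := record_leg N pg ruler_lt hO.
have [Out3 [s3 leg3]] := record_leg N heavy_geodesic ruler_lt hO.
pose Out x := Out1 x ++ Out2 x ++ Out3 x; exists Out; split=> [x|].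
  by rewrite !size_cat !mulSn mul0n addn0 !leq_add.
have G1 x y : y \in Out1 x -> y != x -> out_graph Out x y.
  by move=> yx ne; rewrite /out_graph eq_sym ne !mem_cat yx.
have G2 x y : y \in Out2 x -> y != x -> out_graph Out x y.
  by move=> yx ne; rewrite /out_graph eq_sym ne !mem_cat yx !orbT.
have G3 x y : y \in Out3 x -> y != x -> out_graph Out x y.
  by move=> yx ne; rewrite /out_graph eq_sym ne !mem_cat yx !orbT.
have g_sym := out_graph_sym Out; have [_ d_sym d_tri] := m.
have bet a b c : anc a b -> anc b c -> between d c b a.
  move=> ab bc; rewrite /between (anc_dist e_tree ab) (anc_dist e_tree bc).
  rewrite (anc_dist e_tree (anc_trans e_tree ab bc)).
  by have := anc_dep e_tree ab; have := anc_dep e_tree bc; lia.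
(* The rank is largest at [w], but the climb may stop earlier, at a vertex [x] of the same rank on
   the path of [w]. *)
have climb w u : anc w u -> exists x,
    [/\ anc w x, anc x u, rk x = rk w & reach d (out_graph Out) t u x].
  move=> wu; have wE := ancE wu.
  have [|i [i_s imax ui]] := leg1 _ G1 u (dep u - dep w).
    by have := dep_lt u; lia.
  have xu := anc_iter r e_tree i u; set x := iter i par u in imax ui xu.
  have wx : anc w x.
    apply: (anc_dep_le e_tree wu xu); rewrite dep_iter //.
    by have := anc_dep e_tree wu; lia.
  exists x; split=> //; apply/eqP; rewrite eqn_leq rk_anc //=.
  by have := imax _ (leqnn _); rewrite -wE.
(* Going up from [x] and down from [w], each leg stops at a maximum of [ruler] on the same stretch;
   uniqueness of the maximum makes them meet. *)
have across w x : anc w x -> rk x = rk w -> reach d (out_graph Out) (t + t) x w.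
  move=> wx rx; have wE := ancE wx; have xE := heavy_chain wx rx.
  have dwx := anc_dep e_tree wx; set s := dep x - dep w in wE xE.
  have sN : s < N by have := dep_lt x; lia.
  have [i [i_s imax xc]] := leg2 _ G2 x s sN.
  have [j [j_s jmax wc]] := leg3 _ G3 w s sN.
  have stretch k : k <= s -> iter k par x = iter (s - k) heavy w.
    move=> ks; set y := iter k par x.
    have yx : anc y x := anc_iter r e_tree k x.
    have dy : dep y = dep x - k by apply: dep_iter.
    have wy : anc w y by apply: (anc_dep_le e_tree wx yx); lia.
    have ry : rk y = rk w.
      by apply/eqP; rewrite eqn_leq rk_anc //= -rx rk_anc.
    by rewrite {1}(heavy_chain wy ry) dy; congr iter; lia.
  have jE := stretch (s - j) (leq_subr _ _); rewrite subKn // in jE.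
  have di : dep (iter i par x) = dep x - i by apply: dep_iter.
  have dj : dep (iter (s - j) par x) = dep x - (s - j) by apply: dep_iter.
  have rij : ruler (iter i par x) = ruler (iter (s - j) par x).
    apply/eqP; rewrite eqn_leq imax ?leq_subr // andbT jE.
    by rewrite stretch // jmax // leq_subr.
  have ijE : i = s - j.
    apply/eqP; apply: contraT => neq.
    (* Were the two stopping points distinct, a vertex strictly between their depths [p] and [q]
       would have a larger [ruler]. The successors below match the shift in [ruler]. *)
    pose p := minn (dep x - i) (dep x - (s - j)).
    pose q := maxn (dep x - i) (dep x - (s - j)).
    have [l lpq] : exists2 l, p.+1 < l < q.+1 & logn 2 p.+1 < logn 2 l.
      apply: logn2_between; first by rewrite /p /q; lia.
      move: rij; rewrite /ruler di dj /p /q.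
      by case: leqP => _ ->.
    rewrite ltnNge => /negP[]; have := imax (dep x - l.-1).
    rewrite /ruler di dep_iter // => lmax.
    have -> : logn 2 l = logn 2 (dep x - (dep x - l.-1)).+1.
      by congr logn; move: lpq; rewrite /p /q; lia.
    apply: leq_trans (lmax _) _; first by move: lpq; rewrite /p /q; lia.
    by move: rij; rewrite /ruler di dj /p; case: (leqP (dep x - i)) => _ ->.
  have cx := anc_iter r e_tree i x.
  apply: (reach_trans m (w := iter i par x)) => //.
    apply: bet => //; apply: (anc_dep_le e_tree wx cx); lia.
  by apply: (reach_sym m) => //; rewrite ijE jE.
have side u v w x : anc w u -> anc x u -> anc w x -> rk x = rk w ->
    between d u w v -> reach d (out_graph Out) t u x ->
    reach d (out_graph Out) t v w -> reach d (out_graph Out) (4 * t) u v.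
  move=> wu xu wx rx uwv ux vw.
  apply: (@reach_widen _ _ m _ ((t + (t + t)) + t)); first by lia.
  apply: (reach_trans m uwv); last exact: (reach_sym m).
  by apply: (reach_trans m (bet _ _ _ wx xu)) => //; apply: across.
move=> u v; have [w [wu wv duv wmax]] := lca r e_tree u v.
have uwv : between d u w v.
  by rewrite /between duv (anc_dist e_tree wu) d_sym (anc_dist e_tree wv).
have [x [wx xu rx ux]] := climb w u wu; have [y [wy yv ry vy]] := climb w v wv.
(* Vertices below [w] of the rank of [w] lie on one descending path. So the upper one of [x] and [y]
   is a common ancestor of [u] and [v], hence is [w]. *)
have fork a b : anc w a -> anc w b -> rk a = rk w -> rk b = rk w ->
    dep a <= dep b -> anc a b.
  move=> wa wb ra rb ab; have dwa := anc_dep e_tree wa.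
  rewrite (heavy_chain wb rb) (_ : _ - _ = (dep b - dep a) + (dep a - dep w)).
    by rewrite iterD -(heavy_chain wa ra) heavy_iter_anc.
  by lia.
have top a : anc w a -> anc a u -> anc a v -> a = w.
  move=> wa au av; have aw := wmax a au av.
  apply: anc_dep_eq au wu _.
  by have := anc_dep e_tree wa; have := anc_dep e_tree aw; lia.
have [xy|/ltnW yx] := leqP (dep x) (dep y).
  have xw := top x wx xu (anc_trans e_tree (fork x y wx wy rx ry xy) yv).
  apply: (reach_sym m) => //; apply: (side v u w y) => //.
    by rewrite (between_sym m).
  by rewrite -[X in reach _ _ _ _ X]xw.
have yw := top y wy (anc_trans e_tree (fork y x wy wx ry rx yx) xu) yv.
by apply: (side u v w x) => //; rewrite -[X in reach _ _ _ _ X]yw.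
Qed.

End HeavyPath.

(** * Bounds *)

Lemma reach_shortcutting (V : finType) (e : rel V) (Out : V -> seq V) t k :
    is_tree e -> t <= k ->
    (forall u v, reach (gdist e) (out_graph Out) t u v) ->
  is_shortcutting e k (out_graph Out).
Proof.
move=> e_tree tk hop; have g_graph := out_graph_is_graph Out.
split=> // u v; have [_ g_irr] := g_graph.
have [p [? ? sp ?]] := reach_path (tree_metric e_tree) g_irr (hop u v).
by exists p; split=> //; apply: leq_trans tk.
Qed.

Import Order.TTheory GRing.Theory Num.Theory.
Local Open Scope ring_scope.

Section Bounds.
Variable R : realType.

(** [B] is the least solution: its predecessor is at most the [t]-th root of [h], and this root is
    at least 1, so rounding up costs a factor 2. *)
Lemma root_bound (h t : nat) : (0 < h)%N -> (0 < t)%N -> exists B : nat,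
  [/\ (0 < B)%N, (h <= B ^ t)%N & B%:R <= 2%:R * h%:R `^ (t%:R^-1) :> R].
Proof.
move=> h_gt0 t_gt0.
have ex : exists B, (h <= B ^ t)%N.
  by exists h; rewrite -{1}(expn1 h) leq_pexp2l.
have t0 : t%:R != 0 :> R by rewrite pnatr_eq0 -lt0n.
have h1 : 1 <= h%:R `^ (t%:R^-1) :> R.
  rewrite -[X in X <= _](powRr0 h%:R) ler_powR ?invr_ge0 ?ler0n //.
  by rewrite (ler_nat _ 1).
case: (ex_minnP ex) => B hB Bmin; exists B; split=> //.
  by rewrite lt0n; apply/eqP => B0; move: hB; rewrite B0 exp0n //; lia.
case: B hB Bmin => [|[|B]] hB Bmin; first by rewrite mulr_ge0 ?powR_ge0.
  by lra.
have {Bmin} Bh : (B.+1 ^ t <= h)%N.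
  by rewrite leqNgt; apply/negP => /ltnW /Bmin; rewrite ltnn.
have : B.+1%:R <= h%:R `^ (t%:R^-1) :> R.
  have -> : B.+1%:R = (B.+1 ^ t)%:R `^ (t%:R^-1) :> R.
    by rewrite natrX -powR_mulrn ?ler0n // -powRrM divff // powRr1 ?ler0n.
  by rewrite ge0_ler_powR ?invr_ge0 ?nnegrE ?ler0n // ler_nat.
have : 1 <= B.+1%:R :> R by rewrite (ler_nat _ 1).
by rewrite -[B.+2]addn1 natrD; lra.
Qed.

(** Digits give out-degree [t * B <= 7 * B] for [t < 8]; jumps give [2 * B + 1 <= 3 * B] otherwise.
    With the factor 2 of rounding, 14 covers both. *)
Lemma scheme_bound (h t : nat) (x : R) : (0 < h)%N -> (0 < t)%N ->
    ((t < 8)%N -> t%:R^-1 <= x) -> ((8 <= t)%N -> (t./2)%:R^-1 <= x) ->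
  exists O D, scheme h t D O /\ D%:R <= 14%:R * h%:R `^ x.
Proof.
move=> h_gt0 t_gt0 x_small x_big.
have h_mono y : y <= x -> h%:R `^ y <= h%:R `^ x.
  by move=> yx; rewrite ler_powR // (ler_nat _ 1).
have [t8|t8] := ltnP t 8.
  have [B [B_gt0 hB Bh]] := root_bound h_gt0 t_gt0.
  have [O hO] := digit_scheme t B_gt0.
  exists O, (t * B)%N; split; first exact: scheme_widen hO.
  have := h_mono _ (x_small t8); have := powR_ge0 h%:R (t%:R^-1 : R).
  have : t%:R <= 7%:R :> R by rewrite ler_nat.
  have : 0 <= t%:R :> R by [].
  by rewrite natrM; nra.
have [|B [B_gt0 hB Bh]] := @root_bound h t./2 h_gt0; first by lia.
have [O hO] := jump_scheme t./2 B_gt0.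
exists O, (2 * B).+1; split; first by apply: scheme_widen hO; lia.
have := h_mono _ (x_big t8); have : 1 <= B%:R :> R by rewrite (ler_nat _ 1).
by rewrite -addn1 natrD natrM; lra.
Qed.

(** Invert the inequality [exp (- 1/2) >= 1 - 1/2]. *)
Lemma ln2_ge : 2%:R^-1 <= ln 2%:R :> R.
Proof.
rewrite -ler_expR lnK ?posrE //.
have := expR_ge1Dx (- 2%:R^-1 : R); rewrite expRN => le.
rewrite -[X in _ <= X]invrK -[X in X <= _]invrK.
rewrite lef_pV2 ?posrE ?invr_gt0 ?expR_gt0 //.
by lra.
Qed.

Lemma trunc_log_le_ln (n : nat) : (1 < n)%N ->
  (trunc_log 2 n).+1%:R <= 4%:R * ln n%:R :> R.
Proof.
move=> n1; set T := trunc_log 2 n.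
have T1 : (0 < T)%N by rewrite /T trunc_log_gt0.
have Tn : (2 ^ T <= n)%N by rewrite trunc_logP // ltnW.
have : T%:R * ln 2%:R <= ln n%:R :> R.
  rewrite mulrC mulr_natr -lnXn // -natrX ler_ln ?posrE ?ltr0n ?expn_gt0 //.
    by rewrite ler_nat.
  exact: ltnW.
have : T%:R * 2%:R^-1 <= T%:R * ln 2%:R :> R by rewrite ler_wpM2l ?ln2_ge.
have : 1 <= T%:R :> R by rewrite (ler_nat _ 1).
by rewrite -(addn1 T) natrD; lra.
Qed.

(** Since the exponent is at most [s], a factor [c] inside the power costs a constant independent of
    the exponent. *)
Lemma powR_scale (a c : nat) (b x : R) (s : nat) : 0 <= b -> 0 <= x <= s%:R ->
  (0 < c)%N -> a%:R <= c%:R * b -> a%:R `^ x <= c%:R ^+ s * b `^ x.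
Proof.
move=> b0 /andP[x0 xs] c0 ab; apply: (@le_trans _ _ ((c%:R * b) `^ x)).
  by rewrite ge0_ler_powR ?nnegrE ?mulr_ge0.
rewrite powRM // ler_wpM2r ?powR_ge0 // -powR_mulrn // ler_powR //.
by rewrite (ler_nat _ 1).
Qed.

Lemma inv_le_ratio (t a k : nat) : (0 < t)%N -> (k + 4 <= a * t)%N ->
  t%:R^-1 <= a%:R / (k + 4)%:R :> R.
Proof.
move=> t0 le; rewrite ler_pdivlMr ?ltr0n ?addn_gt0 ?orbT //.
by rewrite mulrC ler_pdivrMr ?ltr0n // -natrM ler_nat.
Qed.

Lemma log_shortcutting (V : finType) (e : rel V) (k : nat) : is_tree e ->
    (1 < #|V|)%N -> (1 < k)%N -> exists2 g : rel V, is_shortcutting e k g &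
  (arboricity g)%:R <= 2000%:R * ln #|V|%:R `^ (12%:R / (k + 4)%:R) :> R.
Proof.
move=> e_tree n1 k1; have [_ /card_gt0P[r _] _ _] := e_tree.
set x : R := _ / _; set h := (trunc_log 2 #|V|).+1.
have x_itv : 0 <= x <= 2%:R.
  rewrite /x divr_ge0 //= ler_pdivrMr ?ltr0n ?addn_gt0 ?orbT // -natrM ler_nat.
  by lia.
have ln0 : 0 <= ln #|V|%:R :> R by rewrite ln_ge0 // (ler_nat _ 1) ltnW.
have hx : h%:R `^ x <= 4%:R ^+ 2 * ln #|V|%:R `^ x.
  exact: powR_scale (trunc_log_le_ln n1).
have [k4|k4] := ltnP k 4.
  have [Out [sOut hop]] := centroid_shortcut r e_tree.
  exists (out_graph Out); first exact: reach_shortcutting hop.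
  (* For [k] equal to 2 or 3 the exponent is at least [12 / 7], so the linear bound of the centroids
     is enough. *)
  have : h%:R <= h%:R `^ x.
    rewrite -{1}(powRr1 (ler0n _ h)) ler_powR ?(ler_nat _ 1) //.
    by rewrite -invr1 (@inv_le_ratio 1) //; lia.
  have : (arboricity (out_graph Out))%:R <= (2 * h)%:R :> R.
    by rewrite ler_nat arboricity_out_graph.
  by rewrite natrM; have := powR_ge0 (ln #|V|%:R) x; lra.
have [|||O [D [hO Dh]]] := @scheme_bound h (k %/ 4) x isT.
- by lia.
- by move=> k8; apply: inv_le_ratio; lia.
- by move=> k8; apply: inv_le_ratio; lia.
have [Out [sOut hop]] := log_shortcut r e_tree hO.
exists (out_graph Out); first by apply: reach_shortcutting hop => //; lia.
have : (arboricity (out_graph Out))%:R <= (2 * (3 * D))%:R :> R.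
  by rewrite ler_nat arboricity_out_graph.
(* The constant is [2 * 3 * 14 * 4 ^ 2 = 1344]. *)
by rewrite !natrM; have := powR_ge0 (ln #|V|%:R) x; lra.
Qed.

Lemma height_shortcutting (V : finType) (e : rel V) (k : nat) (r : V) :
    is_tree e -> (1 < #|V|)%N -> (1 < k)%N -> k != 3%N ->
  exists2 g : rel V, is_shortcutting e k g &
  (arboricity g)%:R <= 2000%:R * (height e r)%:R `^ (6%:R / (k + 4)%:R) :> R.
Proof.
move=> e_tree n1 k1 k3; set x : R := _ / _; set h := height e r.
have dep_le v : (gdist e r v <= h)%N by apply: (leq_bigmax v).
have h_gt0 : (0 < h)%N.
  have [u [v [_ _ uv]]] := card_gt1P n1.
  have [w wr] : exists w, w != r.
    by have [ur|] := eqVneq u r; [exists v; rewrite -ur eq_sym | exists u].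
  apply: leq_trans (dep_le w); have [d0 _ _] := tree_metric e_tree.
  by rewrite lt0n d0 eq_sym.
have x_itv : 0 <= x <= 1.
  rewrite /x divr_ge0 //= ler_pdivrMr ?ltr0n ?addn_gt0 ?orbT // mul1r ler_nat.
  by lia.
(* Depths range over [h.+1] values, and [h.+1 <= 2 * h]. *)
have hx : h.+1%:R `^ x <= 2%:R ^+ 1 * h%:R `^ x.
  by apply: powR_scale => //; rewrite -natrM ler_nat; lia.
have [|||O [D [hO Dh]]] := @scheme_bound h.+1 k./2 x isT.
- by lia.
(* Among [k >= 2], [k + 4 <= 6 * k./2] fails at 3 only. The next goal, with [t = k./2], follows from
   [2 * t + 5 <= 6 * t./2], true for [t >= 8] but false at 7; hence the threshold 8. *)
- by move=> k8; apply: inv_le_ratio; move/eqP: k3; lia.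
- by move=> k8; apply: inv_le_ratio; lia.
have [Out [sOut hop]] :=
  height_shortcut e_tree (dep_le : forall v, (_ < h.+1)%N) hO.
exists (out_graph Out); first by apply: reach_shortcutting hop => //; lia.
have : (arboricity (out_graph Out))%:R <= (2 * D)%:R :> R.
  by rewrite ler_nat arboricity_out_graph.
by rewrite natrM; have := powR_ge0 h%:R x; lra.
Qed.

End Bounds.

(** For [k = 1] the only shortcutting is the complete graph, whose arboricity is linear in [n]. For
    [k = 3] one hop on each side would give the exponent 1 instead of [6 / 7], and only the
    logarithmic bound is stated. *)
Theorem theorem1p3 (R : realType) :
  exists2 C : R, 0 < C &
    forall (n k : nat) (V : finType) (e : rel V),
      (1 <= n)%N -> (1 <= k)%N -> is_tree e -> #|V| = n ->
      exists g : rel V,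
        [/\ is_shortcutting e k g,
            (k != 1)%N ->
              (arboricity g)%:R <= C * ln n%:R `^ (12%:R / (k + 4)%:R)
          & (k != 1)%N -> (k != 3)%N ->
              forall r : V,
                (arboricity g)%:R
                  <= C * (height e r)%:R `^ (6%:R / (k + 4)%:R)].
Proof.
exists 2000%:R => // n k V e n_gt0 k_gt0 e_tree nE; subst n.
(* On a single vertex both bounds are 0, so the arboricity has to vanish exactly. *)
have trivial_case : (#|V| <= 1)%N || (k == 1%N) -> exists g : rel V,
    is_shortcutting e k g /\ ((k != 1%N) -> arboricity g = 0%N).
  move=> n1k1; exists (out_graph (fun=> enum V)); split; last first.
    move=> k1; rewrite arboricity_card1 //.
    by move: n1k1; rewrite (negPf k1) orbF.
  apply: (@reach_shortcutting _ _ _ 1%N) => // u v.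
  apply: (reach1 (tree_metric e_tree)); rewrite /out_graph !mem_enum andbT.
  by rewrite eq_sym orbN.
have [/trivial_case[g [gk g0]]|] := boolP ((#|V| <= 1)%N || (k == 1%N)).
  exists g; split=> // [/g0->|/g0-> _ r]; by rewrite mulr_ge0 ?powR_ge0.
rewrite negb_or -ltnNge => /andP[n1 k1].
have k2 : (1 < k)%N by lia.
have [g1 g1k g1_log] := log_shortcutting R e_tree n1 k2.
have [k3|k3] := eqVneq k 3%N; first by exists g1; split=> //; rewrite k3.
have [_ /card_gt0P[r0 _] _ _] := e_tree.
(* The graph is fixed before the root, so it is built for a root of least height. *)
case: (@arg_minnP _ r0 predT (height e) isT) => r _ r_min.
have [g2 g2k g2_height] := height_shortcutting R r e_tree n1 k2 k3.
have height_mono r' : (height e r)%:R `^ (6%:R / (k + 4)%:R)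
                   <= (height e r')%:R `^ (6%:R / (k + 4)%:R) :> R.
  by rewrite ge0_ler_powR ?nnegrE ?divr_ge0 // ler_nat r_min.
have [g12|g21] := leqP (arboricity g1) (arboricity g2).
  exists g1; split=> // _ _ r'; apply: le_trans (_ : (arboricity g2)%:R <= _).
    by rewrite ler_nat.
  by apply: le_trans g2_height _; rewrite ler_pM2l.
exists g2; split=> // [_|_ _ r'].
  by apply: le_trans g1_log; rewrite ler_nat ltnW.
by apply: le_trans g2_height _; rewrite ler_pM2l.
Qed.
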